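(* Let $X$ be a face-transitive surface. Then the vertex-face type $\mathrm{vf}(X)$ of $X$ satisfies $$\mathrm{vf}(X)\in\{(3,1),(2,1),(2,2),(1,1),(1,2),(1,3),(1,6)\}.$$
   Context: A simplicial complex $X$ on a finite non-empty set $P$ is a non-empty family of subsets of $P$ closed under taking subsets; $X_i$ denotes the set of its elements of cardinality $i+1$; elements of $X_0,X_1,X_2$ are vertices, edges, faces. A simplicial surface is a simplicial complex $X$ such that: all inclusion-maximal elements have cardinality $3$; every edge is contained in exactly two faces; and for every vertex $v$ the faces containing $v$ can be arranged in a cyclic sequence $(F_1,\dots,F_n)$ (each occurring once) with $|F_i\cap F_{i+1}|=2$ for all $i$ (subscripts modulo $n$). All simplicial surfaces are assumed strongly connected (any two faces are joined by a sequence of faces in which consecutive faces share an edge). $\mathrm{Aut}(X)$ is the group of automorphisms of $X$ (equivalently, permutations of $X_0$ mapping faces to faces). $X$ is face-transitive if $\mathrm{Aut}(X)$ acts transitively on $X_2$. For a face-transitive surface $X$, the vertex-face type is $\mathrm{vf}(X)=(a,s)$, where $a$ is the number of orbits of $\mathrm{Aut}(X)$ on $X_0$ and $s=|\mathrm{stab}_{\mathrm{Aut}(X)}(F)|$ is the order of the (setwise) stabiliser of a face $F\in X_2$ (independent of $F$). *)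

(* Defs.v *)
From HB Require Import structures.
From mathcomp Require Import all_boot all_fingroup.

Set Implicit Arguments.
Unset Strict Implicit.
Unset Printing Implicit Defensive.

Import GroupScope.

Section SimplicialSurfaces.
Variable P : finType.
Implicit Types (X : {set {set P}}) (A B F G e v : {set P}).

Definition simplicial_complex X : Prop :=
  [/\ 0 < #|P|,
      X != set0
    & forall A B, A \in X -> B \subset A -> B \in X].

(* The vertices are the singletons in X, not the points of P: a point of P
   need not lie in any simplex. *)
Definition simplices X (i : nat) : {set {set P}} :=
  [set A in X | #|A| == i.+1].

Definition vertices X := simplices X 0.
Definition edges X := simplices X 1.
Definition faces X := simplices X 2.

Definition faces_at X v : {set {set P}} := [set F in faces X | v \subset F].

(* [path.cycle] also tests the pair formed by the last and the first entry, which
   gives the subscripts modulo n; for n = 1 it would require #|F :&: F| = 2. *)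
Definition umbrella X v : Prop :=
  exists c : seq {set P},
    [/\ uniq c, c =i faces_at X v & path.cycle (fun F G => #|F :&: G| == 2) c].

Definition edge_adjacent X : rel {set P} :=
  fun F G => [&& F \in faces X, G \in faces X &
    [exists e in edges X, (e \subset F) && (e \subset G)]].

Definition strongly_connected X : Prop :=
  {in faces X &, forall F G, connect (edge_adjacent X) F G}.

Definition simplicial_surface X : Prop :=
  [/\ simplicial_complex X,
      forall A, maxset (mem X) A -> #|A| = 3,
      {in edges X, forall e, #|faces_at X e| = 2},
      {in vertices X, forall v, umbrella X v}
    & strongly_connected X].

Definition vertex_points X : {set P} := [set p | [set p] \in X].

(* A permutation of X_0 is represented by its extension by the identity to P,
   so that points of P outside X do not contribute automorphisms. *)
Definition AutX X : {group {perm P}} :=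
  'N_(Sym (vertex_points X))(X | 'P^*)%G.

Lemma AutXP X (g : {perm P}) :
  reflect (perm_on (vertex_points X) g /\ {in X, forall A, g @: A \in X})
          (g \in AutX X).
Proof.
rewrite !inE /=; apply: (iffP andP) => -[Vg gX]; split=> //.
  by move=> A XA; move/subsetP/(_ A XA): gX; rewrite !inE.
by apply/subsetP=> A XA; rewrite !inE; apply: gX.
Qed.

Lemma AutX_facesP X (g : {perm P}) :
    simplicial_complex X -> (forall A, maxset (mem X) A -> #|A| = 3) ->
  reflect (perm_on (vertex_points X) g /\ {in faces X, forall F, g @: F \in faces X})
          (g \in AutX X).
Proof.
move=> [_ _ subX] maxX; apply: (iffP (AutXP X g)) => -[Vg gX]; split=> //.
  by move=> F; rewrite !inE card_imset; [case/andP=> /gX-> | apply: perm_inj].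
move=> A XA; have [F maxF sAF] := maxset_exists (P := mem X) (XA : mem X A).
have: F \in faces X by rewrite inE (maxX _ maxF) eqxx andbT; exact: (maxsetp maxF).
by move/gX; rewrite inE => /andP[XgF _]; apply: subX XgF (imsetS _ sAF).
Qed.

Definition face_transitive X : Prop :=
  [transitive AutX X, on faces X | 'P^*].

Definition vertex_orbits X : {set {set {set P}}} :=
  orbit 'P^* (AutX X) @: vertices X.

(* For face-transitive X this does not depend on the face F: see
   [vf_face_indep]. *)
Definition vf X F : nat * nat :=
  (#|vertex_orbits X|, #|'C_(AutX X)[F | 'P^*]|).

Lemma vf_face_indep X :
  face_transitive X -> {in faces X &, forall F G, vf X F = vf X G}.
Proof.
move=> trX F G XF XG; congr (_, _).
have := card_orbit_stab 'P^* (AutX X) F.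
rewrite -(card_orbit_stab 'P^* (AutX X) G) !(atransP trX) //.
by move/eqP; rewrite eqn_pmul2l => [/eqP //|]; apply/card_gt0P; exists F.
Qed.

End SimplicialSurfaces.

(* Main.v *)
Require Import Defs.
From mathcomp Require Import all_boot all_fingroup.

(** An automorphism fixing a face pointwise fixes every adjacent face pointwise,
    since an edge lies in only two faces; by strong connectivity it is trivial.
    Hence the stabiliser S of a face F embeds in the symmetric group of F, and
    even in that of any part of F whose complement in F it fixes pointwise.  By
    face-transitivity the vertex orbits are the classes of the points of F, and S
    preserves each class.  So S fixes every point which is alone in its class,
    and |S| divides 1, 2 or 6 when there are 3, 2 or 1 classes. *)

Set Implicit Arguments.
Unset Strict Implicit.
Unset Printing Implicit Defensive.

(** Restriction to [B] embeds [S] in the symmetric group of [B], where Lagrange applies.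
    Divisibility, unlike a mere bound, will exclude the orders 4 and 5. *)
Lemma card_faithful_dvdn_fact (T : finType) (S : {group {perm T}}) (B : {set T}) :
  S \subset 'N(B | 'P)%g -> 'C_S(B | 'P)%g = 1%g -> #|S| %| #|B|`!.
Proof.
move=> nBS cBS.
have injS : ('injm (restrm nBS (restr_perm B)))%g.
  by rewrite ker_restrm ker_restr_perm cBS.
rewrite -(card_injm injS (subxx S)) -card_Sym cardSg //.
apply/subsetP=> _ /morphimP[g _ Sg ->] /=.
by rewrite inE; apply: restr_perm_on.
Qed.

Section Surface.
Import GroupScope.
Variables (P : finType) (X : {set {set P}}).
Hypothesis surfX : simplicial_surface X.
Implicit Types (F G : {set P}) (g : {perm P}).

Definition point_orbit (p : P) : {set {set P}} := orbit 'P^* (AutX X) [set p].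

Lemma card_face F : F \in faces X -> #|F| = 3.
Proof. by rewrite inE => /andP[_ /eqP]. Qed.

Lemma AutX_face g F : g \in AutX X -> F \in faces X -> g @: F \in faces X.
Proof.
case: surfX => cX maxX _ _ _ /(AutX_facesP _ cX maxX)[_].
exact.
Qed.

Lemma vertex_in_face p :
  p \in vertex_points X -> exists2 F, F \in faces X & p \in F.
Proof.
case: surfX => _ maxX _ _ _; rewrite inE => Xp.
have [F maxF] := maxset_exists (P := mem X) (Xp : mem X [set p]).
rewrite sub1set => Fp; exists F => //.
by rewrite inE (maxX _ maxF) eqxx andbT; apply: (maxsetp maxF).
Qed.

Lemma face_point F p : F \in faces X -> p \in F -> p \in vertex_points X.
Proof.
case: surfX => -[_ _ subX] _ _ _ _; rewrite !inE => /andP[XF _] Fp.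
by apply: subX XF _; rewrite sub1set.
Qed.

Lemma fix_adjacent_face g F G :
    g \in AutX X -> edge_adjacent X F G ->
  {in F, forall p, g p = p} -> {in G, forall p, g p = p}.
Proof.
move=> Ag /and3P[XF XG /exists_inP[e Xe /andP[sFe sGe]]] fixF.
have [_ _ /(_ e Xe) card_e _ _] := surfX.
have [<- // | neqFG] := eqVneq F G.
have faces_e : faces_at X e = [set F; G].
  apply/esym/eqP; rewrite eqEcard card_e cards2 neqFG leqnn andbT.
  by apply/subsetP=> H /set2P[]->; rewrite inE ?XF ?XG.
have fix_im (A : {set P}) : {in A, forall p, g p = p} -> g @: A = A.
  move=> fixA; rewrite (eq_in_imset (g := id)) ?imset_id //.
have fixe : {in e, forall p, g p = p} by move=> p /(subsetP sFe)/fixF.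
(* [g @: G] contains [g @: e = e], so it is [F] or [G]. It is not [F], since [g] already maps [F] to
   itself and acts injectively on sets. *)
have gG : g @: G = G.
  have : g @: G \in faces_at X e.
    by rewrite inE AutX_face //= -{1}(fix_im e fixe) imsetS.
  rewrite faces_e !inE => /orP[/eqP | /eqP //].
  rewrite -{1}(fix_im F fixF) => /(imset_inj (@perm_inj _ g)) eqGF.
  by rewrite eqGF eqxx in neqFG.
(* [g] preserves both [G] and [e], hence fixes the single vertex [w] of [G] off [e]. *)
have /cards1P[w Dw] : #|G :\: e| == 1%N.
  rewrite cardsDS // card_face //.
  by move: Xe; rewrite inE => /andP[_ /eqP->].
move=> p Gp; have [/fixe // | e'p] := boolP (p \in e).
have inw q : q \in G -> q \notin e -> q = w.
  by move=> Gq e'q; apply/set1P; rewrite -Dw inE e'q.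
rewrite [RHS]inw //; apply: inw; first by rewrite -gG imset_f.
by rewrite -(fix_im e fixe) mem_imset //; apply: perm_inj.
Qed.

Lemma fix_face_eq1 g F :
    F \in faces X -> g \in AutX X -> {in F, forall p, g p = p} -> g = 1.
Proof.
move=> XF Ag fixF; have [_ _ _ _ conX] := surfX.
have fix_face G : G \in faces X -> {in G, forall p, g p = p}.
  move=> XG; have /connectP[c] := conX F G XF XG.
  (* Induction on the path with its first face general: being fixed pointwise passes on to the next
     face. *)
  move=> + ->; elim: c F fixF {XF XG G} => //= H c IHc F fixF.
  by case/andP=> /(fix_adjacent_face Ag)/(_ fixF); apply: IHc.
have /AutXP[Vg _] := Ag.
apply/permP=> p; rewrite perm1.
have [/vertex_in_face[G XG] | V'p] := boolP (p \in vertex_points X).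
  exact: fix_face.
exact: out_perm Vg V'p.
Qed.

Lemma point_orbit_perm g p : g \in AutX X -> point_orbit (g p) = point_orbit p.
Proof.
move=> Ag; apply/orbit_eqP/orbitP; exists g => //=.
by rewrite /setact imset_set1.
Qed.

Lemma face_stab_point_orbit F g p :
    g \in 'C_(AutX X)[F | 'P^*] -> p \in F ->
  g p \in F /\ point_orbit (g p) = point_orbit p.
Proof.
case/setIP=> Ag /astab1P gF Fp; split; last exact: point_orbit_perm.
by rewrite -gF; apply: imset_f.
Qed.

(** The stabiliser fixes each point of [F] outside [B], so it preserves [B]; an element that also
    fixes [B] pointwise fixes [F] pointwise and is trivial. *)
Lemma face_stab_dvdn_fact F (B : {set P}) :
    F \in faces X -> B \subset F ->
    {in F :\: B & F, forall p q, point_orbit q = point_orbit p -> q = p} ->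
  #|'C_(AutX X)[F | 'P^*]| %| #|B|`!.
Proof.
move=> XF sBF aloneFB.
apply: card_faithful_dvdn_fact.
  apply/subsetP=> g Sg; rewrite !inE; apply/subsetP=> p Bp.
  rewrite inE /= apermE.
  have Fp := subsetP sBF p Bp; have [Fgp Ogp] := face_stab_point_orbit Sg Fp.
  apply: contraT => B'gp.
  have gp : p = g p by apply: aloneFB; rewrite // inE B'gp.
  by rewrite -gp Bp in B'gp.
apply/trivgP/subsetP=> g /setIP[Sg /astabP fixB].
rewrite inE; apply/eqP/(fix_face_eq1 XF); first by case/setIP: Sg.
move=> p Fp; have [/fixB // | B'p] := boolP (p \in B).
have [Fgp Ogp] := face_stab_point_orbit Sg Fp.
by apply: aloneFB; rewrite // inE B'p.
Qed.

Lemma vertex_orbitsE F :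
  face_transitive X -> F \in faces X -> vertex_orbits X = point_orbit @: F.
Proof.
move=> trX XF; apply/setP=> O; apply/imsetP/imsetP=> -[].
  move=> v; rewrite inE => /andP[Xv /cards1P[p Dv]] ->.
  have [|G XG Gp] := @vertex_in_face p; first by rewrite inE -Dv.
  (* The face [G] at [p] is an image of [F], so [p] is the image of a point of [F]. *)
  have [g Ag DG] := atransP2 trX XF XG.
  move: Gp; rewrite DG => /imsetP[q Fq Dp]; exists q => //.
  by rewrite Dv Dp; apply: point_orbit_perm.
move=> p Fp ->; exists [set p] => //.
by rewrite inE cards1 eqxx andbT; have := face_point XF Fp; rewrite inE.
Qed.

End Surface.

Theorem theorem3p8 (P : finType) (X : {set {set P}}) (F : {set P}) :
  simplicial_surface X -> face_transitive X -> F \in faces X ->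
  vf X F \in [:: (3, 1); (2, 1); (2, 2); (1, 1); (1, 2); (1, 3); (1, 6)].
Proof.
move=> surfX trX XF; rewrite /vf (vertex_orbitsE surfX trX XF).
(* Used with [B] equal to [F], to [F] without a point alone in its class, and to the empty set; the
   factorials are 6, 2 and 1. *)
have dvdS := face_stab_dvdn_fact surfX XF.
have cardF := card_face XF.
have dvd6 : #|'C_(AutX X)[F | 'P^*]%g| %| 6.
  rewrite -[6]/(3`!) -cardF; apply: dvdS => // p q.
  by rewrite setDv inE.
have cardFp p : p \in F -> #|F :\ p| = 2.
  by have := cardsD1 p F; rewrite cardF => + Fp; rewrite Fp => -[].
have dvd2 p : p \in F ->
    {in F, forall q, point_orbit X q = point_orbit X p -> q = p} ->
    #|'C_(AutX X)[F | 'P^*]%g| %| 2.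
  move=> Fp alone_p.
  rewrite -[2]/(2`!) -(cardFp p Fp); apply: dvdS; first exact: subD1set.
  move=> r q; rewrite !inE => /andP[+ Fr]; rewrite Fr andbT negbK => /eqP->.
  exact: alone_p.
have dvd1 : {in F &, injective (point_orbit X)} ->
    #|'C_(AutX X)[F | 'P^*]%g| %| 1.
  move=> injF; rewrite -[1]/(0`!) -(cards0 P); apply: dvdS (sub0set F) _.
  by move=> p q; rewrite setD0 => Fp Fq; apply: injF.
have /card_gt0P[x Fx] : 0 < #|F| by rewrite cardF.
have /cards2P[y [z [neq_yz DF]]] : #|F :\ x| == 2.
  by rewrite cardFp.
(* Only counting remains: [s] and the orbit map are generalised, keeping just the three
   divisibilities. *)
move: #|'C_(AutX X)[F | 'P^*]%g| dvd6 dvd2 dvd1 => s.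
rewrite -(setD1K Fx) DF !imsetU1 imset_set1.
move: (point_orbit X) => O dvd6 dvd2 dvd1.
(* The boolean condition, that [p] is alone in its class, can be settled by rewriting with the known
   coincidences among [O x], [O y], [O z]. *)
have alone p : p \in x |: [set y; z] ->
    [&& (O x == O p) ==> (x == p), (O y == O p) ==> (y == p)
      & (O z == O p) ==> (z == p)] -> s = 1 \/ s = 2.
  move=> Fp /and3P[xp yp zp]; suff: s %| 2.
    by case: s {dvd6 dvd2 dvd1} => [|[|[|s]]] //; auto; move/dvdn_leq; apply.
  apply: dvd2 Fp _ => q; rewrite !inE => Fq Oq; apply/eqP.
  by case/or3P: Fq Oq => /eqP-> /eqP; apply: implyP.
(* The number of classes now depends only on these coincidences. When there are two classes, the
   point left alone is [z], [y] or [x] in turn. *)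
rewrite !cardsU1 cards1 !inE.
have [Oxy | nOxy] := eqVneq (O x) (O y).
  rewrite -Oxy; have [Oxz | nOxz] := eqVneq (O x) (O z).
    by case: s dvd6 {dvd2 dvd1 alone} => [|[|[|[|[|[|[|s]]]]]]] // /dvdn_leq; apply.
  have [||->|->] := alone z; rewrite ?inE ?eqxx ?orbT //.
  by rewrite -Oxy (negPf nOxz).
have [Oxz | nOxz] := eqVneq (O x) (O z).
  rewrite -Oxz (eq_sym (O y)) (negPf nOxy).
  have [||->|->] := alone y; rewrite ?inE ?eqxx ?orbT //.
  by rewrite -Oxz (negPf nOxy).
have [Oyz | nOyz] := eqVneq (O y) (O z).
  have [||->|->] := alone x; rewrite ?inE ?eqxx //.
  by rewrite !(eq_sym _ (O x)) (negPf nOxy) (negPf nOxz).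
suff /eqP-> : s == 1 by [].
rewrite -dvdn1; apply: dvd1 => p q; rewrite !inE.
by move=> /or3P[]/eqP-> /or3P[]/eqP-> // /eqP;
  rewrite ?(negPf nOxy, negPf nOxz, negPf nOyz) // eq_sym
          ?(negPf nOxy, negPf nOxz, negPf nOyz).
Qed.
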